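(* Let $(u,v)$ satisfy the boundary conditions and the divergence-free condition of the context. Then $$\Big(\iint|u|^pr^{\frac{\delta p}2}r^{\frac12}\,dR\,d\omega\Big)^{1/p}\lesssim\|u\|_X\quad\text{for }4\le p<\infty,$$ and $$\Big(\iint|u|^pr^{\frac{\delta p}2}\,dR\,d\omega\Big)^{1/p}\lesssim\|u\|_X\quad\text{for }2\le p<4.$$
   Context: $R_0>0$, $\theta_0>0$ (small), $0<\varepsilon\le1$, $\delta\in[0,1]$. $(\omega,R)\in\Omega=(0,\theta_0)\times(R_0,\infty)$; $r=r(R)=R_0+\sqrt\varepsilon(R-R_0)$; $\iint=\int_0^{\theta_0}\int_{R_0}^\infty\cdot\,dR\,d\omega$. Boundary conditions: $u=v=0$ on $\{\omega=0\}$ and on $\{R=R_0\}$; $\varepsilon v_\omega+ru_R=0$ on $\{\omega=\theta_0\}$ (and, for the associated pressure $P$, $Pr=2\varepsilon u_\omega$ there). Divergence-free condition: $\frac1ru_\omega+\frac{\sqrt\varepsilon}rv+v_R=0$, i.e. $u_\omega+\partial_R(rv)=0$. Norm: $\|u\|_X^2=\iint(u^2r^\delta+u_\omega^2r^\delta+u_R^2r^{1+\delta})$. The implicit constant may depend on $p$ but not on $\varepsilon$ or $u$. *)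

(* Defs.v *)
From HB Require Import structures.
From mathcomp Require Import all_boot all_order all_algebra.
From mathcomp Require Import all_classical all_reals all_analysis.
Set Implicit Arguments.
Unset Strict Implicit.
Unset Printing Implicit Defensive.
Import Order.TTheory GRing.Theory Num.Theory.
Import numFieldNormedType.Exports.
Local Open Scope classical_set_scope.
Local Open Scope ring_scope.

Section Sector.
Context {K : realType}.

(* Points of the plane are pairs x = (omega, R). *)
Definition d_omega (f : K * K -> K) (x : K * K) : K := 'D_((1, 0) : K * K) f x.
Definition d_R (f : K * K -> K) (x : K * K) : K := 'D_((0, 1) : K * K) f x.

Definition Omega (R0 theta0 : K) : set (K * K) :=
  `]0, theta0[%classic `*` `]R0, +oo[%classic.

(* Meant for open D: two-sided derivatives. *)
Definition C1_on (D : set (K * K)) (f : K * K -> K) : Prop :=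
  forall x, D x ->
    [/\ derivable f x (1, 0), derivable f x (0, 1),
        {for x, continuous (d_omega f)} & {for x, continuous (d_R f)}].

Definition r_eps (eps R0 s : K) : K := R0 + Num.sqrt eps * (s - R0).

(* The functions of interest live on the open set Omega; their value at a
   boundary point is the limit from within Omega, so no value taken outside
   Omega matters, nor does a two-sided derivative at the boundary. *)
Definition vanishes_at (R0 theta0 : K) (f : K * K -> K) (b : K * K) : Prop :=
  f x @[x --> within (Omega R0 theta0) (nbhs b)] --> (0 : K).

(* The faces are taken without the corners. P is the pressure; it is
   constrained by the last condition only. *)
Definition boundary_conditions (R0 theta0 eps : K) (u v P : K * K -> K) : Prop :=
  let r := fun x : K * K => r_eps eps R0 x.2 in
  [/\ forall s, R0 < s ->
        vanishes_at R0 theta0 u (0, s) /\ vanishes_at R0 theta0 v (0, s),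
      forall w, 0 < w < theta0 ->
        vanishes_at R0 theta0 u (w, R0) /\ vanishes_at R0 theta0 v (w, R0),
      forall s, R0 < s ->
        vanishes_at R0 theta0
          (fun x => eps * d_omega v x + r x * d_R u x) (theta0, s) &
      forall s, R0 < s ->
        vanishes_at R0 theta0
          (fun x => P x * r x - 2 * eps * d_omega u x) (theta0, s)].

Definition divergence_free (R0 theta0 eps : K) (u v : K * K -> K) : Prop :=
  forall x, Omega R0 theta0 x ->
    let r := r_eps eps R0 x.2 in
    r^-1 * d_omega u x + Num.sqrt eps / r * v x + d_R v x = 0.

Definition iint (R0 theta0 : K) (f : K * K -> K) : \bar K :=
  (\int[lebesgue_measure]_(w in `]0%R, theta0[)
     \int[lebesgue_measure]_(s in `]R0, +oo[) (f (w, s))%:E)%E.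

(* Extended-real valued: it is +oo when the integral diverges. *)
Definition normX (R0 theta0 eps delta : K) (u : K * K -> K) : \bar K :=
  let r := fun x : K * K => r_eps eps R0 x.2 in
  (iint R0 theta0 (fun x => (u x) ^+ 2 * r x `^ delta
                     + (d_omega u x) ^+ 2 * r x `^ delta
                     + (d_R u x) ^+ 2 * r x `^ (1 + delta))%R `^ 2^-1)%E.

End Sector.

(* Main.v *)
(** Put w = u r^(delta/2) / M with M close to ||u||_X, so that the energy
    integral of w^2 + w_omega^2 + r w_R^2 is bounded by a constant. Since w
    vanishes on {omega = 0} and {R = R0}, integrating the derivatives of w^(n+1)
    and of w^(n+1) r^(1/2) from these two faces and using AM-GM gives
      |w^(n+1)| <= int F domega   and   |w^(n+1) r^(1/2)| <= int F dR,
    with F = c (w^(2n) + w^2 + w_omega^2 + r w_R^2). The first right-hand side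
    depends on R only and the second on omega only, so by Tonelli the integral of
    w^(2n+2) r^(1/2) is at most the square of the integral of F. As r >= R0, this
    bounds all even moments by induction on n; the real exponents p follow from
    |w|^p <= w^(2m) + w^(2n) for 2m <= p <= 2n. *)
Require Import Defs.
From HB Require Import structures.
From mathcomp Require Import all_boot all_order all_algebra.
From mathcomp Require Import all_classical all_reals all_analysis.
From mathcomp Require Import measurable_realfun ring lra.
Set Implicit Arguments.
Unset Strict Implicit.
Unset Printing Implicit Defensive.
Import Order.TTheory GRing.Theory Num.Theory.
Import numFieldNormedType.Exports.
Local Open Scope classical_set_scope.
Local Open Scope ring_scope.

(** * Measurability in the plane: open sets and continuous functions *)

Section PlaneMeasurability.
Context {K : realType}.
Local Notation plane := (measurableTypeR K * measurableTypeR K)%type.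

(** The product sigma-algebra is generated by rectangles: [U] is the union of the boxes with
    rational corners that it contains, and these are countably many. *)
Lemma open_plane_measurable (U : set (K * K)) : open U -> measurable (U : set plane).
Proof.
move=> oU.
pose box (q : (rat * rat) * (rat * rat)) : set (K * K) :=
  `]ratr q.1.1, ratr q.1.2[%classic `*` `]ratr q.2.1, ratr q.2.2[%classic.
have -> : U = \bigcup_(q in [set q | box q `<=` U]) box q.
  apply/seteqP; split => [[x y] Uxy|x [q /= qU] /qU //].
  have /nbhs_ballP[e /= e0 eU] : nbhs (x, y) U by exact: open_nbhs_nbhs.
  have [a] := @rat_in_itvoo K (x - e) x ltac:(lra).
  have [b] := @rat_in_itvoo K x (x + e) ltac:(lra).
  have [c] := @rat_in_itvoo K (y - e) y ltac:(lra).
  have [d] := @rat_in_itvoo K y (y + e) ltac:(lra).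
  rewrite !in_itv/= => /andP[d1 d2] /andP[c1 c2] /andP[b1 b2] /andP[a1 a2].
  exists ((a, b), (c, d)) => /=; last first.
    by split => /=; rewrite in_itv/=; apply/andP; split.
  move=> [z t] [/=]; rewrite !in_itv/= => /andP[z1 z2] /andP[t1 t2].
  apply: eU; split => /=; rewrite /ball/= ltr_norml; apply/andP; split; lra.
rewrite bigcup_mkcond; apply: countable_bigcupT_measurable => // q.
case: ifP => _; last exact: measurable0.
by apply: measurableX; exact: measurable_itv.
Qed.

Lemma open_continuous_measurable_plane (U : set (K * K)) (f : K * K -> K) :
  open U -> {in U, continuous f} -> measurable_fun (U : set plane) f.
Proof.
move=> oU cf.
apply: (measurability _ (RGenOInfty.measurableE K)).
move=> /= _ [_ [a ->]] <-.
apply: open_plane_measurable; rewrite openE => x [Ux fx].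
have nU : nbhs x U by exact: open_nbhs_nbhs.
apply: filterI => //; apply: (cf x (mem_set Ux)).
by apply: open_nbhs_nbhs; split => //; exact: interval_open.
Qed.

End PlaneMeasurability.

(** * An anisotropic product inequality from Tonelli *)

Section AnisotropicProduct.
Context d1 d2 (T1 : measurableType d1) (T2 : measurableType d2) (K : realType).
Variables (m1 : {sigma_finite_measure set T1 -> \bar K})
  (m2 : {sigma_finite_measure set T2 -> \bar K}).
Local Open Scope ereal_scope.

(** One section integral depends on [y] alone and the other on [x] alone, so the integral of their
    product factors; by Tonelli each factor equals the double integral of [F]. *)
Lemma integral_le_sectional_product (F G : T1 * T2 -> \bar K) :
  measurable_fun setT F -> (forall x, 0 <= F x) ->
  measurable_fun setT G -> (forall x, 0 <= G x) ->
  (forall x y, G (x, y) <= (\int[m1]_t F (t, y)) * (\int[m2]_t F (x, t))) ->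
  \int[m1]_x \int[m2]_y G (x, y) <=
    (\int[m1]_x \int[m2]_y F (x, y)) * (\int[m1]_x \int[m2]_y F (x, y)).
Proof.
move=> mF F0 mG G0 GF.
pose A y := \int[m1]_t F (t, y).
pose B x := \int[m2]_t F (x, t).
have A0 y : 0 <= A y by exact: integral_ge0.
have B0 x : 0 <= B x by exact: integral_ge0.
have mA : measurable_fun setT A by exact: (measurable_fun_fubini_tonelli_G (m1 := m1) F).
have mB : measurable_fun setT B by exact: (measurable_fun_fubini_tonelli_F (m2 := m2) F).
have IA : \int[m2]_y A y = \int[m1]_x \int[m2]_y F (x, y) by rewrite (fubini_tonelli F).
rewrite -[X in _ <= X * _]IA -/(B _).
have -> : (\int[m2]_y A y) * (\int[m1]_x B x) = \int[m1]_x ((\int[m2]_y A y) * B x).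
  by rewrite ge0_integralZl//; exact: integral_ge0.
apply: ge0_le_integral => //.
- by move=> x _; exact: integral_ge0.
- exact: (measurable_fun_fubini_tonelli_F (m2 := m2) G).
- exact: emeasurable_funM.
move=> x _; rewrite -ge0_integralZr//.
apply: ge0_le_integral => //.
- exact: measurableT_comp.
- exact: emeasurable_funM.
Qed.

End AnisotropicProduct.

(** * Calculus of the iterated integral over the sector *)

Section IteratedIntegral.
Context {K : realType} (R0 theta0 : K).
Local Notation mu := (@lebesgue_measure K).
Local Notation plane := (measurableTypeR K * measurableTypeR K)%type.
Local Notation D := (Omega R0 theta0 : set plane).
Local Notation I := (iint R0 theta0).

Lemma open_Omega : open (Omega R0 theta0).
Proof.
rewrite openE => -[x y] [/= x0 y0].
exists (`]0, theta0[%classic, `]R0, +oo[%classic) => //=; split;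
  apply: open_nbhs_nbhs; split; by [exact: interval_open|].
Qed.

Lemma measurable_Omega : measurable D.
Proof. by apply: open_plane_measurable; exact: open_Omega. Qed.
Hint Resolve measurable_Omega : core.

Lemma iint_restrict (f : K * K -> K) :
  I f = (\int[mu]_x \int[mu]_y ((EFin \o f) \_ D) (x, y))%E.
Proof.
rewrite /iint integral_mkcond; apply: eq_integral => x _.
rewrite /patch; case: ifPn => xD; last first.
  rewrite integral0_eq// => y _; rewrite /= memNset// => -[/= xD' _].
  by move: xD; rewrite mem_set.
rewrite integral_mkcond; apply: eq_integral => y _; rewrite /patch /=.
have [yD|yD] := boolP (y \in _); first by rewrite mem_set//; split; exact/set_mem.
by rewrite memNset// => -[/= _ yD']; move: yD; rewrite mem_set.
Qed.

(** Monotonicity, additivity and homogeneity of [iint] are read off from this single integral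
    against the product measure. *)
Lemma iint_product (f : K * K -> K) :
  measurable_fun D f -> (forall x, D x -> 0 <= f x) ->
  I f = (\int[(mu \x mu)%E]_(x in D) (f x)%:E)%E.
Proof.
move=> mf f0; rewrite iint_restrict [RHS]integral_mkcond fubini_tonelli1//.
- by apply/(measurable_restrictT _ _).1 => //; exact/measurable_EFinP.
- by apply: erestrict_ge0 => x Dx /=; rewrite lee_fin f0.
Qed.

Lemma iint_ge0 (f : K * K -> K) : (forall x, D x -> 0 <= f x) -> (0 <= I f)%E.
Proof.
move=> f0; apply: integral_ge0 => x /= x0; apply: integral_ge0 => y /= y0.
by rewrite lee_fin f0.
Qed.

Lemma le_iint (f g : K * K -> K) :
  measurable_fun D f -> measurable_fun D g -> (forall x, D x -> 0 <= f x) ->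
  (forall x, D x -> f x <= g x) -> (I f <= I g)%E.
Proof.
move=> mf mg f0 fg; have g0 x : D x -> 0 <= g x.
  by move=> Dx; apply: le_trans (fg _ Dx); exact: f0.
rewrite !iint_product//; apply: ge0_le_integral => //.
- exact/measurable_EFinP.
- exact/measurable_EFinP.
Qed.

Lemma eq_iint (f g : K * K -> K) : (forall x, D x -> f x = g x) -> I f = I g.
Proof.
move=> fg; apply: eq_integral => x /set_mem x0; apply: eq_integral => y /set_mem y0.
by rewrite fg.
Qed.

Lemma iintD (f g : K * K -> K) :
  measurable_fun D f -> measurable_fun D g -> (forall x, D x -> 0 <= f x) ->
  (forall x, D x -> 0 <= g x) -> (I (fun x => f x + g x)%R = I f + I g)%E.
Proof.
move=> mf mg f0 g0; rewrite !iint_product//.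
- under eq_integral do rewrite EFinD.
  by rewrite ge0_integralD//; exact/measurable_EFinP.
- exact: measurable_funD.
- by move=> x Dx; rewrite addr_ge0 ?f0 ?g0.
Qed.

Lemma iintZ (c : K) (f : K * K -> K) :
  measurable_fun D f -> (forall x, D x -> 0 <= f x) -> 0 <= c ->
  (I (fun x => c * f x)%R = c%:E * I f)%E.
Proof.
move=> mf f0 c0; rewrite !iint_product//.
- under eq_integral do rewrite EFinM.
  by rewrite ge0_integralZl_EFin//; exact/measurable_EFinP.
- exact: measurable_funM.
- by move=> x Dx; rewrite mulr_ge0 ?f0.
Qed.

End IteratedIntegral.

(** * Bounding a function with zero boundary value by the integral of its derivative *)

Section NormLeIntegral.
Context {K : realType}.
Local Notation mu := (@lebesgue_measure K).

(** The fundamental theorem of calculus is applied on [[y, x]] with [a < y], then [y] tends to [a];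
    the endpoint enters only through the limit of [f]. Integrating [h] over the whole line makes the
    bound independent of [x]. *)
Lemma norm_le_integral_derivative (D : set K) (a : K) (f g : K -> K) (h : K -> \bar K) :
  (forall x, D x -> a < x) -> (forall x y, D x -> a < y <= x -> D y) ->
  (forall x, D x -> is_derive x 1 f (g x)) ->
  (forall x, D x -> {for x, continuous g}) ->
  f y @[y --> a^'+] --> 0 ->
  measurable_fun [set: measurableTypeR K] h -> (forall x, 0 <= h x)%E ->
  (forall x, D x -> (`|g x|%:E <= h x)%E) ->
  forall x, D x -> (`|f x|%:E <= \int[mu]_t h t)%E.
Proof.
move=> aD Dint df cg f0 mh h0 gh x Dx.
have sub y z : a < y -> z \in `[y, x] -> D z.
  rewrite in_itv/= => ay /andP[yz zx]; apply: Dint Dx _.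
  by rewrite zx andbT (lt_le_trans ay).
have cgy y : a < y -> {within `[y, x], continuous g}.
  by move=> ay; apply: continuous_in_subspaceT => z /set_mem/= zyx; exact/cg/(sub y).
have cf z : D z -> {for z, continuous f}.
  by move=> Dz; apply/differentiable_continuous/derivable1_diffP; have [] := df _ Dz.
have key y : a < y -> y < x -> ((`|f x| - `|f y|)%:E <= \int[mu]_t h t)%E.
  move=> ay yx.
  have Dy : D y by apply: (sub y) => //; rewrite in_itv/= lexx ltW.
  have ftc : (\int[mu]_(t in `[y, x]) (g t)%:E = (f x)%:E - (f y)%:E)%E.
    apply: continuous_FTC2 => //; first exact: cgy.
      split.
      - move=> z zxy; have [] // := df z; apply: (sub y) => //.
        exact: subset_itv_oo_cc zxy.
      - exact/cvg_at_right_filter/cf.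
      - exact/cvg_at_left_filter/cf.
    move=> z zxy; rewrite derive1E; apply: derive_val; apply: df; apply: (sub y) => //.
    exact: subset_itv_oo_cc zxy.
  have mg : measurable_fun `[y, x] g.
    by apply: subspace_continuous_measurable_fun => //; exact: cgy.
  apply: (@le_trans _ _ `|\int[mu]_(t in `[y, x]) (g t)%:E|%E).
    by rewrite ftc -EFinB /= lee_fin; apply: lerB_dist.
  apply: le_trans (le_abse_integral _ _ _) _ => //; first exact/measurable_EFinP.
  apply: (@le_trans _ _ (\int[mu]_(t in `[y, x]) h t)%E).
    apply: ge0_le_integral => //.
    - by apply: measurableT_comp => //; exact/measurable_EFinP.
    - exact: measurable_funTS.
    - by move=> z zxy; apply: gh; exact: (sub y).
  exact: ge0_subset_integral.
have ax := aD _ Dx.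
(* The bound is trivial if the integral is +oo; the value -oo is excluded by [key] at the midpoint
   of [a] and [x]. *)
case: (\int[mu]_t h t)%E key => [j key| _|key]; last 2 first.
- exact: leey.
- by have := key ((a + x) / 2) ltac:(lra) ltac:(lra).
rewrite lee_fin leNgt; apply/negP => jf.
near a^'+ => y.
have ay : a < y by [].
have yx : y < x by near: y; exact: nbhs_right_lt.
(* If [j] were below [|f x|], the zero limit would give a [y] at which [key] fails. *)
have : `|f y| < `|f x| - j.
  by near: y; apply: (cvgr_norm_lt 0 f0); rewrite normr0 subr_gt0.
have := key y ay yx; rewrite lee_fin; lra.
Unshelve. all: by end_near.
Qed.

End NormLeIntegral.

(** * The core estimate: two sectional bounds and the moment step *)

Section CoreEstimate.
Context {K : realType}.
Local Notation mu := (@lebesgue_measure K).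
Local Notation plane := (measurableTypeR K * measurableTypeR K)%type.

(** [wo] and [wR] stand for the partial derivatives. Differentiability, continuity and zero traces
    are asked along coordinate lines, where one-variable calculus is applied; measurability is
    joint, for Tonelli. *)
Record regular_trace0 (R0 theta0 : K) (w wo wR : K * K -> K) : Prop := {
  measurable_fct : measurable_fun (Omega R0 theta0 : set plane) w;
  measurable_omega : measurable_fun (Omega R0 theta0 : set plane) wo;
  measurable_R : measurable_fun (Omega R0 theta0 : set plane) wR;
  is_derive_omega : forall x s, Omega R0 theta0 (x, s) ->
    is_derive x 1 (fun t => w (t, s)) (wo (x, s));
  is_derive_R : forall x s, Omega R0 theta0 (x, s) ->
    is_derive s 1 (fun t => w (x, t)) (wR (x, s));
  continuous_omega : forall x s, Omega R0 theta0 (x, s) ->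
    {for x, continuous (fun t => wo (t, s))};
  continuous_R : forall x s, Omega R0 theta0 (x, s) ->
    {for s, continuous (fun t => wR (x, t))};
  trace_omega : forall s, R0 < s -> w (t, s) @[t --> 0^'+] --> 0;
  trace_R : forall x, 0 < x < theta0 -> w (x, t) @[t --> R0^'+] --> 0 }.

Context (R0 theta0 eps : K).
Hypotheses (R0_gt0 : 0 < R0) (eps01 : 0 < eps <= 1).
Local Notation r := (r_eps eps R0).
Local Notation D := (Omega R0 theta0 : set plane).
Local Notation I := (iint R0 theta0).

Lemma is_derive_pow (f : K -> K) (x df : K) n : is_derive x 1 f df ->
  is_derive x 1 (fun t => f t ^+ n.+1) (n.+1%:R * f x ^+ n * df).
Proof.
move=> dfx; have -> : (fun t => f t ^+ n.+1) = f ^+ n.+1.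
  by apply/funext => t; rewrite exprfctE.
exact: is_deriveX.
Qed.

Lemma r_ge s : R0 <= s -> R0 <= r s.
Proof.
by move=> h; rewrite /r_eps lerDl mulr_ge0 ?sqrtr_ge0// subr_ge0.
Qed.

Lemma r_gt0 s : R0 <= s -> 0 < r s.
Proof. by move=> /r_ge; apply: lt_le_trans. Qed.

Lemma is_derive_r (s : K) : is_derive s 1 r (Num.sqrt eps).
Proof.
rewrite /r_eps; apply: is_derive_eq.
by rewrite add0r mul1r subr0 /GRing.scale /= mulr1.
Qed.

Lemma continuous_r : continuous r.
Proof.
move=> s; apply/differentiable_continuous/derivable1_diffP.
by have [] := is_derive_r s.
Qed.

Lemma measurable_sqrt_r (E : set plane) :
  measurable_fun E (fun x : plane => Num.sqrt (r x.2)).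
Proof.
apply: measurable_funTS; apply: (measurableT_comp (f := fun s : measurableTypeR K => Num.sqrt (r s))).
  apply: continuous_measurable_fun => s; apply: continuous_comp.
    exact: continuous_r.
  exact: sqrt_continuous.
exact: measurable_snd.
Qed.

Context (w wo wR : K * K -> K).
Hypothesis reg : regular_trace0 R0 theta0 w wo wR.

(** The integrand of the squared X norm at delta = 0, with [wo] and [wR] as the derivatives. *)
Definition energy (x : K * K) : K := w x ^+ 2 + wo x ^+ 2 + r x.2 * wR x ^+ 2.

(* The factor n + 1 comes from the power rule, (2 sqrt R0)^-1 bounds the
   derivative of r^(1/2). *)
Definition majorant (n : nat) (x : K * K) : K :=
  (n.+1%:R + (2 * Num.sqrt R0)^-1) * (w x ^+ n.*2 + energy x).

Lemma energy_ge0 x : D x -> 0 <= energy x.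
Proof.
case: x => x s [/= _]; rewrite in_itv/= andbT => Rs.
have r0 : 0 <= r s by apply/ltW/r_gt0/ltW.
by rewrite !addr_ge0 ?sqr_ge0// mulr_ge0 ?sqr_ge0.
Qed.

Lemma even_ge0 n x : 0 <= w x ^+ n.*2.
Proof. by rewrite -mul2n exprM exprn_ge0// sqr_ge0. Qed.

Lemma majorant_ge0 n x : D x -> 0 <= majorant n x.
Proof.
move=> Dx; apply: mulr_ge0; last by rewrite addr_ge0 ?even_ge0 ?energy_ge0.
by rewrite addr_ge0// invr_ge0 mulr_ge0 ?sqrtr_ge0.
Qed.

Lemma measurable_r (E : set plane) : measurable_fun E (fun x : plane => r x.2).
Proof.
apply: measurable_funTS; apply: (measurableT_comp (f := r : measurableTypeR K -> _)).
  apply: continuous_measurable_fun; exact: continuous_r.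
exact: measurable_snd.
Qed.

Lemma measurable_energy : measurable_fun D energy.
Proof.
have [mw mo mR _ _ _ _ _ _] := reg.
apply: measurable_funD; first by apply: measurable_funD; exact: measurable_funX.
by apply: measurable_funM; [exact: measurable_r|exact: measurable_funX].
Qed.

Lemma measurable_majorant n : measurable_fun D (majorant n).
Proof.
have [mw mo mR _ _ _ _ _ _] := reg.
apply: measurable_funM => //; apply: measurable_funD; last exact: measurable_energy.
exact: measurable_funX.
Qed.

Let F n := (EFin \o majorant n) \_ D.

Let mF n : measurable_fun setT (F n).
Proof.
apply/(measurable_restrictT _ _).1; first exact: measurable_Omega.
by apply/measurable_EFinP; exact: measurable_majorant.
Qed.

Let F0 n x : (0 <= F n x)%E.
Proof. by apply: erestrict_ge0 => y Dy /=; rewrite lee_fin majorant_ge0. Qed.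

Let FE n x : D x -> F n x = (majorant n x)%:E.
Proof. by move=> Dx; rewrite /F /patch mem_set. Qed.

Lemma normM_le_sqr (a b : K) : `|a * b| <= a ^+ 2 + b ^+ 2.
Proof.
rewrite normrM -(real_normK (num_real a)) -(real_normK (num_real b)).
have := sqr_ge0 (`|a| - `|b|); have := sqr_ge0 `|a|; have := sqr_ge0 `|b|.
by rewrite sqrrB -mulr_natr; lra.
Qed.

Lemma power_le_integral_omega n x s : D (x, s) ->
  (`|w (x, s) ^+ n.+1|%:E <= \int[mu]_t F n (t, s))%E.
Proof.
move=> [/= x0]; rewrite in_itv/= andbT => Rs.
have Dts t : `]0, theta0[%classic t -> D (t, s).
  by move=> t0; split => //=; rewrite in_itv/= Rs.
apply: (@norm_le_integral_derivative K `]0, theta0[%classic 0 (fun t => w (t, s) ^+ n.+1)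
    (fun t => n.+1%:R * w (t, s) ^+ n * wo (t, s))) => //.
- by move=> t /=; rewrite in_itv/= => /andP[].
- move=> t y /=; rewrite !in_itv/= => /andP[t0 tt] /andP[-> yt] /=.
  exact: le_lt_trans tt.
- move=> t t0; have := is_derive_omega reg (Dts _ t0) => dw.
  exact: is_derive_pow.
- move=> t t0; have := is_derive_omega reg (Dts _ t0) => dw.
  apply: continuousM; last exact: (continuous_omega reg (Dts _ t0)).
  apply: continuousM; first exact: cvg_cst.
  apply: (@continuous_comp _ _ _ (fun t => w (t, s)) (fun y => y ^+ n)).
    by apply/differentiable_continuous/derivable1_diffP; have [] := dw.
  exact: exprn_continuous.
(* The exponent n + 1 is positive, so the power still has trace 0. *)
- have := cvg_comp _ _ (trace_omega reg Rs) (@exprn_continuous K n.+1 0).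
  by rewrite expr0n.
- by apply: (measurableT_comp (mF n)); exact: measurable_pair2.
- move=> t /Dts Dt; rewrite FE// lee_fin -mulrA normrM ger0_norm//.
  have := normM_le_sqr (w (t, s) ^+ n) (wo (t, s)); rewrite -exprM muln2 => h.
  have e1 : wo (t, s) ^+ 2 <= energy (t, s).
    have r0 : 0 <= r s by apply/ltW/r_gt0/ltW.
    by rewrite /energy -addrA addrCA lerDl addr_ge0 ?sqr_ge0// mulr_ge0 ?sqr_ge0.
  apply: ler_pM => //; last lra.
  by rewrite lerDl invr_ge0 mulr_ge0 ?sqrtr_ge0.
Qed.

(** In the product rule r^(1/2) pairs with [wR]: w^n times r^(1/2) [wR] is at most w^(2n) + r
    [wR]^2, which is why the energy carries the factor r. The term with the derivative of r^(1/2) is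
    split as w^n times w; its coefficient is at most (2 sqrt R0)^-1 because eps <= 1 and r >= R0. *)
Lemma power_le_integral_R n x s : D (x, s) ->
  (`|w (x, s) ^+ n.+1 * Num.sqrt (r s)|%:E <= \int[mu]_t F n (x, t))%E.
Proof.
move=> [/= x0]; rewrite in_itv/= andbT => Rs.
have Dxt t : R0 < t -> D (x, t).
  by move=> Rt; split => //=; rewrite in_itv/= Rt.
apply: (@norm_le_integral_derivative K `]R0, +oo[%classic R0
    (fun t => w (x, t) ^+ n.+1 * Num.sqrt (r t))
    (fun t => n.+1%:R * w (x, t) ^+ n * wR (x, t) * Num.sqrt (r t)
      + w (x, t) ^+ n.+1 * ((2 * Num.sqrt (r t))^-1 * Num.sqrt eps)));
  rewrite /= ?in_itv/= ?andbT//.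
- by move=> t; rewrite in_itv/= andbT.
- by move=> t y _ /andP[Ry _]; rewrite in_itv/= Ry.
- move=> t; rewrite in_itv/= andbT => Rt.
  have dw := is_derive_pow n (is_derive_R reg (Dxt _ Rt)).
  have rt := r_gt0 (ltW Rt).
  have ds := is_derive1_comp (is_derive1_sqrt rt) (is_derive_r t).
  apply: (is_derive_eq (is_deriveM dw ds)); rewrite /GRing.scale /=.
  by rewrite addrC [X in X + _]mulrC.
- move=> t; rewrite in_itv/= andbT => Rt.
  have dw := is_derive_R reg (Dxt _ Rt).
  have rt := r_gt0 (ltW Rt).
  have cs : {for t, continuous (fun t => Num.sqrt (r t))}.
    by apply: continuous_comp; [exact: continuous_r|exact: sqrt_continuous].
  have cw m : {for t, continuous (fun t => w (x, t) ^+ m)}.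
    apply: (@continuous_comp _ _ _ (fun t => w (x, t)) (fun y => y ^+ m)).
      by apply/differentiable_continuous/derivable1_diffP; have [] := dw.
    exact: exprn_continuous.
  apply: continuousD; apply: continuousM => //.
    apply: continuousM; last exact: (continuous_R reg (Dxt _ Rt)).
    by apply: continuousM => //; exact: cvg_cst.
  apply: continuousM; last exact: cvg_cst.
  apply: continuousV; first by rewrite mulf_neq0// gt_eqF// sqrtr_gt0.
  by apply: continuousM => //; exact: cvg_cst.
- have c0 : Num.sqrt (r t) @[t --> R0^'+] --> Num.sqrt (r R0).
    apply: cvg_at_right_filter.
    by apply: continuous_comp; [exact: continuous_r|exact: sqrt_continuous].
  have := cvgM (cvg_comp _ _ (trace_R reg x0) (@exprn_continuous K n.+1 0)) c0.
  rewrite expr0n mul0r; apply.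
- by apply: (measurableT_comp (mF n)); exact: measurable_pair1.
- move=> t; rewrite in_itv/= andbT => Rt; rewrite FE; last exact: Dxt.
  rewrite lee_fin; apply: le_trans (ler_normD _ _) _.
  have rt := r_gt0 (ltW Rt).
  rewrite /majorant [X in _ <= X]mulrDl lerD//.
    rewrite -!mulrA normrM ger0_norm// ler_pM2l//.
    have := normM_le_sqr (w (x, t) ^+ n) (wR (x, t) * Num.sqrt (r t)).
    rewrite -exprM muln2 exprMn (sqr_sqrtr (ltW rt)) => h; apply: le_trans h _.
    by rewrite lerD2l /energy /= [_ * r t]mulrC lerDr addr_ge0 ?sqr_ge0.
  rewrite mulrC normrM; apply: ler_pM => //.
    rewrite ger0_norm; last by rewrite mulr_ge0 ?sqrtr_ge0// invr_ge0 mulr_ge0 ?sqrtr_ge0.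
    apply: (@le_trans _ _ ((2 * Num.sqrt (r t))^-1 * 1)).
      rewrite ler_wpM2l ?invr_ge0 ?mulr_ge0 ?sqrtr_ge0//.
      by have /andP[_ e1] := eps01; rewrite -sqrtr1 ler_wsqrtr.
    rewrite mulr1 lef_pV2 ?posrE ?mulr_gt0 ?sqrtr_gt0// ler_pM2l//.
    by apply: ler_wsqrtr; apply: r_ge; exact: ltW.
  have := normM_le_sqr (w (x, t) ^+ n) (w (x, t)); rewrite -exprM muln2 -exprSr.
  move=> h; apply: le_trans h _; rewrite lerD2l /energy /= -addrA lerDl.
  by rewrite addr_ge0 ?sqr_ge0// mulr_ge0 ?sqr_ge0// ltW.
Qed.

(** The two sectional bounds multiply to w^(2n+2) r^(1/2): an unweighted moment of order 2n yields a
    weighted one of order 2n + 2. For theta0 > 0 the sector has infinite area, which rules out the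
    input n = 0. *)
Lemma moment_step n b E :
  (I (fun x => w x ^+ n.*2)%R <= b%:E)%E -> (I energy <= E%:E)%E ->
  (I (fun x => w x ^+ n.+1.*2 * Num.sqrt (r x.2))%R
    <= (((n.+1%:R + (2 * Num.sqrt R0)^-1) * (b + E)) ^+ 2)%:E)%E.
Proof.
move=> hb hE.
have [mw mo mR _ _ _ _ _ _] := reg.
have mwk k : measurable_fun D (fun x => w x ^+ k) by exact: measurable_funX.
have c0 : 0 <= n.+1%:R + (2 * Num.sqrt R0)^-1 :> K.
  by rewrite addr_ge0// invr_ge0 mulr_ge0 ?sqrtr_ge0.
have IM : (I (majorant n) <= ((n.+1%:R + (2 * Num.sqrt R0)^-1) * (b + E))%:E)%E.
  rewrite iintZ//; last by move=> x Dx; rewrite addr_ge0 ?even_ge0 ?energy_ge0.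
    rewrite EFinM lee_wpmul2l// ?lee_fin// iintD//; first by rewrite EFinD leeD.
    - exact: measurable_energy.
    - by move=> x _; exact: even_ge0.
    - by move=> x; exact: energy_ge0.
  by apply: measurable_funD => //; exact: measurable_energy.
apply: (@le_trans _ _ (I (majorant n) * I (majorant n))%E); last first.
  have M0 : (0 <= I (majorant n))%E by apply: iint_ge0 => x; exact: majorant_ge0.
  by rewrite expr2 EFinM; apply: lee_pmul.
rewrite [X in (_ <= X * X)%E]iint_restrict iint_restrict.
have G0 x : D x -> 0 <= w x ^+ n.+1.*2 * Num.sqrt (r x.2).
  by move=> _; rewrite mulr_ge0 ?even_ge0 ?sqrtr_ge0.
apply: integral_le_sectional_product => //.
- exact: mF.
- exact: F0.
- apply/(measurable_restrictT _ _).1; first exact: measurable_Omega.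
  by apply/measurable_EFinP; apply: measurable_funM => //; exact: measurable_sqrt_r.
- by apply: erestrict_ge0 => x Dx /=; rewrite lee_fin G0.
move=> x y; rewrite {1}/patch; case: ifPn => [/set_mem Dxy|_]; last first.
  by apply: mule_ge0; apply: integral_ge0 => t _; exact: F0.
apply: le_trans (lee_pmul _ _ (power_le_integral_omega n Dxy) (power_le_integral_R n Dxy));
  rewrite ?lee_fin//=.
by rewrite -normrM mulrA -exprD addnn ler_norm.
Qed.

End CoreEstimate.

(** * Uniform moment bounds, for even and then for real exponents *)

Section Moments.
Context {K : realType}.
Local Notation plane := (measurableTypeR K * measurableTypeR K)%type.

(** Choosing [b] before [eps] and the functions is what carries the uniformity of the final
    constant. [f] receives [eps] because the weight r depends on it. *)
Definition bounded_moment (R0 theta0 E : K) (f : K -> (K * K -> K) -> K * K -> K) : Prop :=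
  exists2 b : K, 0 <= b & forall (eps : K) (w wo wR : K * K -> K),
    0 < eps <= 1 -> regular_trace0 R0 theta0 w wo wR ->
    (iint R0 theta0 (energy R0 eps w wo wR) <= E%:E)%E ->
    (iint R0 theta0 (f eps w) <= b%:E)%E.

Context (R0 theta0 E : K).
Hypotheses (R0_gt0 : 0 < R0) (E_ge0 : 0 <= E).
Local Notation D := (Omega R0 theta0 : set plane).
Local Notation I := (iint R0 theta0).

Lemma OmegaE x s : D (x, s) <-> 0 < x < theta0 /\ R0 < s.
Proof. by rewrite /Omega /setX /= !in_itv/= andbT. Qed.

(** Induction: the square is dominated by the energy, and each further step discards the weight
    r^(1/2) gained from [moment_step], at the cost (sqrt R0)^-1. *)
Lemma bounded_moment_even n :
  bounded_moment R0 theta0 E (fun _ w x => w x ^+ n.+1.*2).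
Proof.
elim: n => [|n [b b0 IH]].
  exists E; first exact: E_ge0.
  move=> eps w wo wR eps01 reg; apply: le_trans.
  have [mw mo mR _ _ _ _ _ _] := reg.
  apply: le_iint.
  - exact: measurable_funX.
  - exact: measurable_energy.
  - by move=> x _; rewrite sqr_ge0.
  - move=> [x s] /OmegaE [_ Rs]; rewrite /energy -addrA lerDl addr_ge0 ?sqr_ge0//.
    by rewrite mulr_ge0 ?sqr_ge0// ltW// (r_gt0 eps R0_gt0 (ltW Rs)).
(* The bound of [moment_step] with n + 1 in place of n, hence the factor n + 2. *)
pose c := ((n.+2%:R + (2 * Num.sqrt R0)^-1) * (b + E)) ^+ 2.
exists ((Num.sqrt R0)^-1 * c).
  by rewrite mulr_ge0 ?invr_ge0 ?sqrtr_ge0 ?sqr_ge0.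
move=> eps w wo wR eps01 reg hE.
have [mw mo mR _ _ _ _ _ _] := reg.
have mwk k : measurable_fun D (fun x => w x ^+ k) by exact: measurable_funX.
have ms : measurable_fun D (fun x => w x ^+ n.+2.*2 * Num.sqrt (r_eps eps R0 x.2)).
  by apply: measurable_funM => //; exact: measurable_sqrt_r.
apply: (@le_trans _ _ ((Num.sqrt R0)^-1%:E *
   I (fun x => w x ^+ n.+2.*2 * Num.sqrt (r_eps eps R0 x.2))%R)%E); last first.
  rewrite EFinM lee_wpmul2l ?lee_fin ?invr_ge0 ?sqrtr_ge0//.
  exact: (moment_step R0_gt0 eps01 reg (IH _ _ _ _ eps01 reg hE) hE).
have s0 x : D x -> 0 <= w x ^+ n.+2.*2 * Num.sqrt (r_eps eps R0 x.2).
  by move=> _; rewrite mulr_ge0 ?sqrtr_ge0 ?even_ge0.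
have c0 : 0 <= (Num.sqrt R0)^-1 by rewrite invr_ge0 sqrtr_ge0.
rewrite -(iintZ ms s0 c0).
apply: le_iint => //.
- by apply: measurable_funM.
- by move=> x _; exact: even_ge0.
move=> [x s] /OmegaE [_ Rs]; rewrite mulrCA ler_peMr ?even_ge0//.
rewrite mulrC ler_pdivlMr ?sqrtr_gt0// mul1r.
by apply: ler_wsqrtr; apply: r_ge => //; exact: ltW.
Qed.

(** Here the last step keeps the weight. Its lowest input is the second moment, so the lowest
    weighted moment is the fourth: this is the origin of the threshold p = 4. *)
Lemma bounded_moment_even_sqrt n :
  bounded_moment R0 theta0 E
    (fun eps w x => w x ^+ n.+2.*2 * Num.sqrt (r_eps eps R0 x.2)).
Proof.
have [b b0 hb] := bounded_moment_even n.
exists (((n.+2%:R + (2 * Num.sqrt R0)^-1) * (b + E)) ^+ 2); first exact: sqr_ge0.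
move=> eps w wo wR eps01 reg hE.
exact: (moment_step R0_gt0 eps01 reg (hb _ _ _ _ eps01 reg hE) hE).
Qed.

(** The larger even power dominates when |a| > 1, the smaller one when |a| <= 1. *)
Lemma powR_norm_le_sum_even (a p : K) m n : 0 < p -> m.*2%:R <= p <= n.*2%:R ->
  `|a| `^ p <= a ^+ m.*2 + a ^+ n.*2.
Proof.
move=> p0 /andP[mp pn].
have ev k : a ^+ k.*2 = `|a| `^ k.*2%:R.
  by rewrite powR_mulrn// -mul2n !exprM real_normK ?num_real.
rewrite !ev; have [a1|a1] := leP `|a| 1; last first.
  by apply: ler_wpDl; [exact: powR_ge0|rewrite ler_powR// ltW].
apply: ler_wpDr; first exact: powR_ge0.
(* Monotonicity in the exponent is applied to a positive base only; at zero the left side vanishes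
   because p is nonzero. *)
have [->|a0] := eqVneq `|a| 0; first by rewrite powR0 ?gt_eqF// powR_ge0.
by apply: ger_powR => //; rewrite lt_neqAle eq_sym a0 normr_ge0.
Qed.

Lemma measurable_norm_powR (w : K * K -> K) p :
  measurable_fun D w -> measurable_fun D (fun x => `|w x| `^ p).
Proof.
move=> mw; apply: (measurableT_comp (measurable_powR p)).
exact: measurableT_comp.
Qed.

(** The exponents 2 and 4 enclose p. The factor 1 is the weight [q] of the general form in which
    both ranges of p are transferred to u. *)
Lemma bounded_moment_powR p : 2 <= p < 4 ->
  bounded_moment R0 theta0 E (fun _ w x => `|w x| `^ p * 1).
Proof.
move=> /andP[p2 p4].
have [b0 b0_ge0 hb0] := bounded_moment_even 0.
have [b1 b1_ge0 hb1] := bounded_moment_even 1.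
exists (b0 + b1); first exact: addr_ge0.
move=> eps w wo wR eps01 reg hE.
have [mw mo mR _ _ _ _ _ _] := reg.
have mwk k : measurable_fun D (fun x => w x ^+ k) by exact: measurable_funX.
apply: (@le_trans _ _ (I (fun x => w x ^+ 2 + w x ^+ 4)%R)).
  apply: le_iint.
  - by apply: measurable_funM => //; exact: measurable_norm_powR.
  - exact: measurable_funD.
  - by move=> x _; rewrite mulr1 powR_ge0.
  - move=> x _; rewrite mulr1; apply: (@powR_norm_le_sum_even _ _ 1 2).
      exact: lt_le_trans p2.
    by rewrite p2 ltW.
rewrite iintD//.
- by rewrite EFinD leeD//; [exact: (hb0 eps _ wo wR)|exact: (hb1 eps _ wo wR)].
- by move=> x _; exact: (even_ge0 w 1).
- by move=> x _; exact: (even_ge0 w 2).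
Qed.

Lemma bounded_moment_powR_sqrt p : 4 <= p ->
  bounded_moment R0 theta0 E
    (fun eps w x => `|w x| `^ p * r_eps eps R0 x.2 `^ 2^-1).
Proof.
move=> p4; pose n := Num.trunc p.
(* With n the integer part of p, p < n + 1 <= 2n + 4, and 2n + 4 is the exponent in
   [bounded_moment_even_sqrt n]. *)
have pn : p <= n.+2.*2%:R.
  apply: le_trans (ltW (truncnS_gt p)) _; rewrite ler_nat -/n -addnn.
  exact: leq_trans (leqnSn _) (leq_addr _ _).
have [b0 b0_ge0 hb0] := bounded_moment_even_sqrt 0.
have [b1 b1_ge0 hb1] := bounded_moment_even_sqrt n.
exists (b0 + b1); first exact: addr_ge0.
move=> eps w wo wR eps01 reg hE.
have [mw mo mR _ _ _ _ _ _] := reg.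
have ms : measurable_fun D (fun x : plane => Num.sqrt (r_eps eps R0 x.2)).
  exact: measurable_sqrt_r.
have mwk k : measurable_fun D (fun x => w x ^+ k * Num.sqrt (r_eps eps R0 x.2)).
  by apply: measurable_funM => //; exact: measurable_funX.
rewrite (@eq_iint _ _ _ _ (fun x => `|w x| `^ p * Num.sqrt (r_eps eps R0 x.2))); last first.
  move=> [x s] /OmegaE[_ Rs]; rewrite powR12_sqrt//=.
  exact/ltW/(r_gt0 _ R0_gt0)/ltW.
apply: (@le_trans _ _ (I (fun x => w x ^+ 4 * Num.sqrt (r_eps eps R0 x.2)
    + w x ^+ n.+2.*2 * Num.sqrt (r_eps eps R0 x.2))%R)).
  apply: le_iint.
  - by apply: measurable_funM => //; exact: measurable_norm_powR.
  - by apply: measurable_funD; exact: mwk.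
  - by move=> x _; rewrite mulr_ge0 ?powR_ge0 ?sqrtr_ge0.
  - move=> x _; rewrite -mulrDl ler_wpM2r ?sqrtr_ge0//.
    apply: (@powR_norm_le_sum_even _ _ 2); last by rewrite p4.
    exact: lt_le_trans p4.
rewrite iintD.
- by rewrite EFinD leeD//; [exact: (hb0 eps _ wo wR)|exact: (hb1 eps _ wo wR)].
- exact: mwk.
- exact: mwk.
- by move=> x _; rewrite mulr_ge0 ?sqrtr_ge0 ?(even_ge0 w 2).
- by move=> x _; rewrite mulr_ge0 ?sqrtr_ge0 ?even_ge0.
Qed.

End Moments.

(** * Partial derivatives as derivatives of slices, and joint continuity *)

Section PartialDerivatives.
Context {K : realType}.
Implicit Types (f : K * K -> K) (x s : K).

(** The difference quotient of [f] in the direction (1, 0) is that of the slice, as the second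
    coordinate moves by h * 0 = 0. *)
Lemma is_derive_d_omega f x s : derivable f (x, s) (1, 0) ->
  is_derive x 1 (fun t => f (t, s)) (d_omega f (x, s)).
Proof.
move=> df.
have e : (fun h : K => h^-1 *: ((f \o shift (x, s)) (h *: ((1, 0) : K * K)) - f (x, s))) =
    (fun h => h^-1 *: (((fun t => f (t, s)) \o shift x) (h *: (1 : K)) - f (x, s))).
  apply/funext => h /=; congr (_ *: (f _ - _)).
  by congr pair; rewrite /= /GRing.scale /= ?mulr0 ?add0r.
split; first by rewrite /derivable -e.
by rewrite /d_omega /derive -e.
Qed.

Lemma is_derive_d_R f x s : derivable f (x, s) (0, 1) ->
  is_derive s 1 (fun t => f (x, t)) (d_R f (x, s)).
Proof.
move=> df.
have e : (fun h : K => h^-1 *: ((f \o shift (x, s)) (h *: ((0, 1) : K * K)) - f (x, s))) =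
    (fun h => h^-1 *: (((fun t => f (x, t)) \o shift s) (h *: (1 : K)) - f (x, s))).
  apply/funext => h /=; congr (_ *: (f _ - _)).
  by congr pair; rewrite /= /GRing.scale /= ?mulr0 ?add0r.
split; first by rewrite /derivable -e.
by rewrite /d_R /derive -e.
Qed.

Lemma continuous_slice_omega f x s : {for (x, s), continuous f} ->
  {for x, continuous (fun t => f (t, s))}.
Proof.
move=> cf; apply: (@continuous_comp _ _ _ (fun t : K => (t, s)) f) => //.
exact: (@cvg_pair _ _ _ _ (nbhs x) (nbhs s) _ _ _ id (cst s) cvg_id (cvg_cst s)).
Qed.

Lemma continuous_slice_R f x s : {for (x, s), continuous f} ->
  {for s, continuous (fun t => f (x, t))}.
Proof.
move=> cf; apply: (@continuous_comp _ _ _ (fun t : K => (x, t)) f) => //.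
exact: (@cvg_pair _ _ _ _ (nbhs x) (nbhs s) _ _ _ (cst x) id (cvg_cst x) cvg_id).
Qed.

(* Near a point, d_omega f is bounded, so f is Lipschitz in omega uniformly in R;
   together with continuity in R this gives joint continuity. *)
Lemma C1_on_continuous (U : set (K * K)) f : open U -> C1_on U f ->
  {in U, continuous f}.
Proof.
move=> oU c1 [x s] /set_mem Uxs.
have [_ dR co _] := c1 _ Uxs.
have cR : {for s, continuous (fun t => f (x, t))}.
  by apply/differentiable_continuous/derivable1_diffP; have [] := is_derive_d_R dR.
pose B := `|d_omega f (x, s)| + 1.
have B0 : 0 < B by rewrite ltr_wpDl.
have nB : \forall y \near (x, s), U y /\ `|d_omega f y| < B.
  apply: filterI; first exact: open_nbhs_nbhs.
  by apply: (cvgr_norm_lt (d_omega f (x, s)) co); rewrite ltrDl.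
have /nbhs_ballP[e /= e0 eB] := nB.
have lip y t : ball x e y -> ball s e t -> `|f (y, t) - f (x, t)| <= B * `|y - x|.
  move=> xy st.
  have inU z : z \in `[Num.min x y, Num.max x y] -> U (z, t) /\ `|d_omega f (z, t)| < B.
    move=> zxy; apply: eB; split => //=; move: zxy xy.
    rewrite in_itv/= /ball/= !ltr_norml; case: (leP x y) => _; lra.
  (* The mean value theorem is used with ordered endpoints; the case y <= x follows by exchanging
     the two points. *)
  have main a b : a <= b -> (forall z, z \in `[a, b] -> U (z, t) /\ `|d_omega f (z, t)| < B) ->
      `|f (b, t) - f (a, t)| <= B * `|b - a|.
    move=> ab h.
    have dz z : z \in `[a, b] -> is_derive z 1 (fun z => f (z, t)) (d_omega f (z, t)).
      by move=> /h[Uz _]; have [do' _ _ _] := c1 _ Uz; exact: is_derive_d_omega.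
    have dz' z : z \in `]a, b[ -> is_derive z 1 (fun z => f (z, t)) (d_omega f (z, t)).
      by move=> zab; apply: dz; exact: subset_itv_oo_cc zab.
    have cz : {within `[a, b], continuous (fun z => f (z, t))}.
      apply: continuous_in_subspaceT => z /set_mem/= /dz dfz.
      by apply/differentiable_continuous/derivable1_diffP; have [] := dfz.
    have [c cab ->] := MVT_segment ab dz' cz.
    by rewrite normrM ler_wpM2r// ltW//; have [] := h c cab.
  case: (leP x y) inU => [xy'|/ltW yx] inU; first exact: main.
  by rewrite distrC (distrC y); exact: main.
apply/cvgrPdist_lt => d d0.
near=> y.
(* Each coordinate is allotted d / 2: an omega-increment below d / (2 B) costs less than that by
   [lip], and the rest is continuity in R on the fixed line omega = x. *)
have [yx ys] : ball x (Num.min e (d / 2 / B)) y.1 /\ ball s e y.2.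
  near: y.
  exists (ball x (Num.min e (d / 2 / B)), ball s e) => //=.
  by split; apply: nbhsx_ballx; rewrite ?lt_min ?e0//= !divr_gt0.
have ft : `|f (x, s) - f (x, y.2)| < d / 2.
  near: y.
  have /cvgrPdist_lt/(_ (d / 2) ltac:(by rewrite divr_gt0)) h := cR.
  by exists (setT, [set t | `|f (x, s) - f (x, t)| < d / 2]) => /=; [split => //; exact: filterT|move=> y []].
have l : `|f y - f (x, y.2)| <= B * `|y.1 - x|.
  rewrite [in f y](surjective_pairing y); apply: lip => //.
  by move: yx; rewrite /ball/= lt_min => /andP[].
have yd : B * `|y.1 - x| < d / 2.
  move: yx; rewrite /ball/= lt_min distrC => /andP[_].
  by rewrite ltr_pdivlMr// mulrC.
rewrite -[_ - _](subrKA (f (x, y.2))); apply: le_lt_trans (ler_normD _ _) _.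
rewrite (splitr d) ltrD// distrC; exact: le_lt_trans l yd.
Unshelve. all: by end_near.
Qed.

End PartialDerivatives.

(** * Transfer to the weighted and normalized function *)

Section Transfer.
Context {K : realType} (R0 theta0 eps delta M : K) (u : K * K -> K).
Hypotheses (R0_gt0 : 0 < R0) (theta0_gt0 : 0 < theta0) (eps01 : 0 < eps <= 1).
Hypotheses (delta01 : 0 <= delta <= 1) (M_gt0 : 0 < M).
Hypothesis C1u : C1_on (Omega R0 theta0) u.
Hypothesis u_omega0 : forall s, R0 < s -> vanishes_at R0 theta0 u (0, s).
Hypothesis u_R0 : forall w, 0 < w < theta0 -> vanishes_at R0 theta0 u (w, R0).
Local Notation plane := (measurableTypeR K * measurableTypeR K)%type.
Local Notation D := (Omega R0 theta0 : set plane).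
Local Notation I := (iint R0 theta0).
Local Notation r := (r_eps eps R0).
Local Notation d2 := (delta / 2).

(** The limit within the sector is restricted to a line: (t, s) lies in the sector for small t > 0,
    since theta0 > 0. *)
Lemma slice_trace_omega s : R0 < s -> u (t, s) @[t --> 0^'+] --> 0.
Proof.
move=> Rs; apply: cvg_trans (u_omega0 Rs).
move=> A [[P Q] [/= P0 Qs] PQ].
suff : \forall t \near 0^'+, A (u (t, s)) by [].
near=> t; apply: (PQ (t, s)).
  split => /=; last exact: nbhs_singleton Qs.
  by near: t; exact: cvg_within.
apply/OmegaE; split => //; apply/andP; split => //.
Unshelve. all: by end_near.
Qed.

Lemma slice_trace_R x : 0 < x < theta0 -> u (x, t) @[t --> R0^'+] --> 0.
Proof.
move=> x0; apply: cvg_trans (u_R0 x0).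
move=> A [[P Q] [/= Px QR] PQ].
suff : \forall t \near R0^'+, A (u (x, t)) by [].
near=> t; apply: (PQ (x, t)).
  split => /=; first exact: nbhs_singleton Px.
  by near: t; exact: cvg_within.
by apply/OmegaE; split.
Unshelve. all: by end_near.
Qed.

Definition weighted (x : K * K) : K := M^-1 * (u x * r x.2 `^ d2).

Definition weighted_omega (x : K * K) : K := M^-1 * (d_omega u x * r x.2 `^ d2).

(** Product rule: the second term differentiates r^(delta/2), and r has slope sqrt eps. *)
Definition weighted_R (x : K * K) : K :=
  M^-1 * (d_R u x * r x.2 `^ d2
          + u x * (d2 * r x.2 `^ (d2 - 1) * Num.sqrt eps)).

Lemma continuous_powR_r a s : R0 <= s -> {for s, continuous (fun t => r t `^ a)}.
Proof.
move=> Rs; apply: (@continuous_comp _ _ _ r (fun y => y `^ a)).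
  exact: continuous_r.
apply: differentiable_continuous; apply/derivable1_diffP.
by have [] := @is_derive1_powR K a (r s) (r_gt0 eps R0_gt0 Rs).
Qed.

Lemma weighted_regular : regular_trace0 R0 theta0 weighted weighted_omega weighted_R.
Proof.
have oO : open (Omega R0 theta0) := @open_Omega K R0 theta0.
have cu := C1_on_continuous oO C1u.
have Rs x s : D (x, s) -> R0 <= s by move=> /OmegaE[_ /ltW].
have co x : D x -> {for x, continuous (d_omega u)} by move=> Dx; have [_ _ ? _] := C1u Dx.
have cR x : D x -> {for x, continuous (d_R u)} by move=> Dx; have [_ _ _ ?] := C1u Dx.
have cux x : D x -> {for x, continuous u} by move=> Dx; apply: cu; exact: mem_set.
have cr a x : D x -> {for x, continuous (fun x => r x.2 `^ a)}.
  case: x => x s Dx; apply: (@continuous_comp _ _ _ (fun x : K * K => x.2) (fun t => r t `^ a)).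
    exact: cvg_snd.
  exact/continuous_powR_r/(Rs x).
have cw x : D x -> {for x, continuous weighted}.
  move=> Dx; apply: continuousM; first exact: cvg_cst.
  by apply: continuousM; [exact: cux|exact: cr].
have cwo x : D x -> {for x, continuous weighted_omega}.
  move=> Dx; apply: continuousM; first exact: cvg_cst.
  by apply: continuousM; [exact: co|exact: cr].
have cwR x : D x -> {for x, continuous weighted_R}.
  move=> Dx; apply: continuousM; first exact: cvg_cst.
  apply: continuousD; first by apply: continuousM; [exact: cR|exact: cr].
  apply: continuousM; first exact: cux.
  apply: continuousM; last exact: cvg_cst.
  by apply: continuousM; [exact: cvg_cst|exact: cr].
split.
- by apply: open_continuous_measurable_plane => // x /set_mem; exact: cw.
- by apply: open_continuous_measurable_plane => // x /set_mem; exact: cwo.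
- by apply: open_continuous_measurable_plane => // x /set_mem; exact: cwR.
- move=> x s Dxs; have [du _ _ _] := C1u Dxs.
  have h := is_deriveZ M^-1 (is_deriveM (is_derive_d_omega du)
    (is_derive_cst (r s `^ d2) x 1)).
  apply: (is_derive_eq h).
  by rewrite /weighted_omega /GRing.scale /= mulr0 add0r [r s `^ _ * _]mulrC.
- move=> x s Dxs; have [_ du _ _] := C1u Dxs.
  have dr := is_derive1_comp (@is_derive1_powR K d2 (r s) (r_gt0 eps R0_gt0 (Rs _ _ Dxs))) (is_derive_r _ _ s).
  have h := is_deriveZ M^-1 (is_deriveM (is_derive_d_R du) dr).
  apply: (is_derive_eq h).
  by rewrite /weighted_R /GRing.scale /= addrC [r s `^ _ * _]mulrC.
- by move=> x s Dxs; apply: continuous_slice_omega; exact: cwo.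
- by move=> x s Dxs; apply: continuous_slice_R; exact: cwR.
- move=> s Rs'.
  have := cvgM (cvg_cst M^-1) (cvgM (slice_trace_omega Rs') (cvg_cst (r s `^ d2))).
  by rewrite mul0r mulr0; apply.
- move=> x x0.
  have c : r t `^ d2 @[t --> R0^'+] --> r R0 `^ d2.
    exact/cvg_at_right_filter/continuous_powR_r.
  have := cvgM (cvg_cst M^-1) (cvgM (slice_trace_R x0) c).
  by rewrite mul0r mulr0; apply.
Qed.

Definition normX_integrand (x : K * K) : K :=
  u x ^+ 2 * r x.2 `^ delta + d_omega u x ^+ 2 * r x.2 `^ delta
  + d_R u x ^+ 2 * r x.2 `^ (1 + delta).

Lemma normX_integrand_ge0 x : 0 <= normX_integrand x.
Proof. by rewrite !addr_ge0// mulr_ge0 ?sqr_ge0 ?powR_ge0. Qed.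

(** Only [weighted_R] needs an argument, because of the term in which the weight is differentiated.
    By (A + B)^2 <= 2 A^2 + 2 B^2 the derivative of u costs a factor 2 and the extra term at most (2
    R0)^-1 times [weighted]^2; both are absorbed in 2 + R0^-1. *)
Lemma energy_weighted_le x : D x ->
  energy R0 eps weighted weighted_omega weighted_R x
    <= (2 + R0^-1) * M^-1 ^+ 2 * normX_integrand x.
Proof.
case: x => x s /OmegaE[_ Rs].
have r0 : 0 < r s by apply: r_gt0 => //; exact: ltW.
have rR : R0 <= r s by apply: r_ge; exact: ltW.
have ne0 : r s != 0 by rewrite gt_eqF.
have e1 : r s `^ delta = (r s `^ d2) ^+ 2.
  by rewrite -powR_mulrn ?powR_ge0// -powRrM; congr (_ `^ _); field.
have e2 : r s `^ (1 + delta) = r s * (r s `^ d2) ^+ 2.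
  by rewrite powRD ?ne0 ?implybT// powRr1 ?ltW// e1.
have e3 : r s `^ (d2 - 1) = r s `^ d2 / r s.
  by rewrite powRD ?ne0 ?implybT// powR_inv1// ltW.
rewrite /energy /weighted /weighted_omega /weighted_R /normX_integrand /= e1 e2 e3.
set a := u _; set b := d_omega _ _; set c := d_R _ _; set p := r s `^ _.
set q := r s in r0 rR ne0 *; set e := Num.sqrt eps.
have /andP[d0 d1] := delta01.
have e_le1 : e ^+ 2 <= 1.
  by have /andP[eps0 eps1] := eps01; rewrite sqr_sqrtr// ltW.
(* The 1/4 is the square of the 1/2 in delta / 2; delta and eps are at most 1. *)
have d2_le : d2 ^+ 2 * e ^+ 2 <= 4^-1.
  have : delta ^+ 2 * e ^+ 2 <= 1 * 1 by rewrite ler_pM ?sqr_ge0// expr_le1.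
  by rewrite exprMn; lra.
have k : q * (c * p + a * (d2 * (p / q) * e)) ^+ 2 <= 2 * q * (c * p) ^+ 2
    + 2^-1 * R0^-1 * (a * p) ^+ 2.
  apply: (@le_trans _ _ (2 * q * (c * p) ^+ 2 + 2 * q^-1 * (d2 ^+ 2 * e ^+ 2) * (a * p) ^+ 2)).
    rewrite -subr_ge0.
    have -> : 2 * q * (c * p) ^+ 2 + 2 * q^-1 * (d2 ^+ 2 * e ^+ 2) * (a * p) ^+ 2
       - q * (c * p + a * (d2 * (p / q) * e)) ^+ 2
       = q * (c * p - a * (d2 * (p / q) * e)) ^+ 2 by field.
    by rewrite mulr_ge0 ?sqr_ge0// ltW.
  rewrite lerD2l ler_wpM2r ?sqr_ge0//.
  have -> : 2^-1 * R0^-1 = 2 * R0^-1 * 4^-1 by field; rewrite gt_eqF.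
  apply: ler_pM => //; first by rewrite mulr_ge0// invr_ge0 ltW.
    by rewrite mulr_ge0 ?sqr_ge0.
  by rewrite ler_pM2l// lef_pV2.
rewrite !exprMn [q * (M^-1 ^+ 2 * _)]mulrCA -!mulrDr [leRHS]mulrAC [leRHS]mulrC ler_wpM2l ?sqr_ge0//.
have R0V : 0 < R0^-1 by rewrite invr_gt0.
have A0 := sqr_ge0 (a * p); have B0 := sqr_ge0 (b * p); have C0 := mulr_ge0 (ltW r0) (sqr_ge0 (c * p)).
rewrite !exprMn in A0 B0 C0 k *.
have := mulr_ge0 (ltW R0V) A0; have := mulr_ge0 (ltW R0V) B0; have := mulr_ge0 (ltW R0V) C0.
move: k. lra.
Qed.

Lemma measurable_normX_integrand : measurable_fun D normX_integrand.
Proof.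
have oO : open (Omega R0 theta0) := @open_Omega K R0 theta0.
have mu : measurable_fun D u.
  by apply: open_continuous_measurable_plane => //; exact: C1_on_continuous.
have mo : measurable_fun D (d_omega u).
  by apply: open_continuous_measurable_plane => // x /set_mem Dx; have [_ _ ? _] := C1u Dx.
have mR : measurable_fun D (d_R u).
  by apply: open_continuous_measurable_plane => // x /set_mem Dx; have [_ _ _ ?] := C1u Dx.
have mr a : measurable_fun D (fun x : plane => r x.2 `^ a).
  apply: (measurableT_comp (measurable_powR a)); exact: measurable_r.
apply: measurable_funD; first apply: measurable_funD.
- by apply: measurable_funM => //; exact: measurable_funX.
- by apply: measurable_funM => //; exact: measurable_funX.
- by apply: measurable_funM => //; exact: measurable_funX.
Qed.

(** The M^-1 ^+ 2 of the normalization cancels M ^+ 2; what remains depends on R0 alone and serves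
    as the level [E] of [bounded_moment]. *)
Lemma iint_energy_weighted_le : (I normX_integrand <= (M ^+ 2)%:E)%E ->
  (I (energy R0 eps weighted weighted_omega weighted_R) <= (2 + R0^-1)%:E)%E.
Proof.
move=> hM; have reg := weighted_regular.
have c0 : 0 <= (2 + R0^-1) * M^-1 ^+ 2.
  by rewrite mulr_ge0 ?sqr_ge0// addr_ge0// invr_ge0 ltW.
have mX := measurable_normX_integrand.
have X0 x : D x -> 0 <= normX_integrand x by move=> _; exact: normX_integrand_ge0.
apply: (@le_trans _ _ (I (fun x => (2 + R0^-1) * M^-1 ^+ 2 * normX_integrand x)%R)).
  apply: le_iint.
  - exact: measurable_energy.
  - exact: measurable_funM.
  - exact: energy_ge0.
  - exact: energy_weighted_le.
rewrite (iintZ mX X0 c0).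
apply: (@le_trans _ _ (((2 + R0^-1) * M^-1 ^+ 2)%:E * (M ^+ 2)%:E)%E).
  by rewrite lee_wpmul2l// lee_fin.
by rewrite -EFinM -mulrA -exprMn mulVf ?gt_eqF// expr1n mulr1.
Qed.

(** Since M |[weighted]| = |u| r^(delta/2), undoing the normalization multiplies the p-th moment by
    M^p. *)
Lemma weighted_moment_le (p b : K) (q : K * K -> K) :
  measurable_fun D q -> (forall x, D x -> 0 <= q x) ->
  (I (fun x => `|weighted x| `^ p * q x)%R <= b%:E)%E ->
  (I (fun x => `|u x| `^ p * r x.2 `^ (delta * p / 2) * q x)%R <= (M `^ p * b)%:E)%E.
Proof.
move=> mq q0 hb; have [mw _ _ _ _ _ _ _ _] := weighted_regular.
rewrite (@eq_iint _ _ _ _ (fun x => M `^ p * (`|weighted x| `^ p * q x))); last first.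
  move=> x Dx; rewrite mulrA -(powRM p (ltW M_gt0) (normr_ge0 _)).
  rewrite (_ : M * `|weighted x| = `|u x| * r x.2 `^ d2); last first.
    rewrite /weighted !normrM (ger0_norm (powR_ge0 _ _)) gtr0_norm ?invr_gt0//.
    by rewrite mulVKf ?gt_eqF.
  rewrite (powRM p (normr_ge0 _) (powR_ge0 _ _)) -powRrM.
  by rewrite [d2 * p]mulrAC.
have mf : measurable_fun D (fun x => `|weighted x| `^ p * q x).
  by apply: measurable_funM => //; exact: measurable_norm_powR.
have f0 x : D x -> 0 <= `|weighted x| `^ p * q x.
  by move=> Dx; rewrite mulr_ge0 ?powR_ge0 ?q0.
by rewrite (iintZ mf f0 (powR_ge0 _ _)) EFinM lee_wpmul2l// lee_fin powR_ge0.
Qed.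

End Transfer.

(** * From normalized moments to the norm inequality *)

(** Treats both ranges of p at once, with [q] equal to r^(1/2) or to 1. *)
Lemma weighted_Lp_le_normX (K : realType) (R0 theta0 p : K) (q : K -> K * K -> K) :
  0 < R0 -> 0 < theta0 -> 0 < p ->
  (forall eps, measurable_fun
     (Omega R0 theta0 : set (measurableTypeR K * measurableTypeR K)) (q eps)) ->
  (forall eps x, 0 <= q eps x) ->
  bounded_moment R0 theta0 (2 + R0^-1) (fun eps w x => `|w x| `^ p * q eps x) ->
  exists2 C : K, 0 < C &
    forall (eps delta : K) (u v P : K * K -> K),
      0 < eps <= 1 -> 0 <= delta <= 1 ->
      C1_on (Omega R0 theta0) u -> boundary_conditions R0 theta0 eps u v P ->
      (iint R0 theta0 (fun x => `|u x| `^ p * r_eps eps R0 x.2 `^ (delta * p / 2)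
         * q eps x)%R `^ p^-1 <= C%:E * normX R0 theta0 eps delta u)%E.
Proof.
move=> R0_gt0 theta0_gt0 p0 mq q0 [b b0 hb].
(* The summand 1 keeps the constant positive when b = 0. *)
exists (b `^ p^-1 + 1); first by rewrite ltr_wpDl// powR_ge0.
move=> eps delta u v P eps01 delta01 C1u [bo bR _ _].
set J := iint _ _ _; set N := normX _ _ _ _ _.
have C0 : 0 < b `^ p^-1 + 1 by rewrite ltr_wpDl// powR_ge0.
have J0 : (0 <= J)%E.
  by apply: iint_ge0 => x _; rewrite !mulr_ge0 ?powR_ge0.
have N0 : (0 <= N)%E by exact: poweR_ge0.
have X0 : (0 <= iint R0 theta0 (normX_integrand R0 eps delta u))%E.
  by apply: iint_ge0 => x _; exact: normX_integrand_ge0.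
have key M : 0 < M -> (N <= M%:E)%E -> (J `^ p^-1 <= ((b `^ p^-1 + 1) * M)%:E)%E.
  move=> M0 NM.
  have hX : (iint R0 theta0 (normX_integrand R0 eps delta u) <= (M ^+ 2)%:E)%E.
    move: NM; rewrite /N /normX -/(normX_integrand R0 eps delta u) poweR12_sqrt//.
    case: (iint _ _ _) X0 => [y|//|//]; rewrite !lee_fin => y0 yM.
    by rewrite -(sqr_sqrtr y0) ler_pXn2r// nnegrE ?sqrtr_ge0// ltW.
  have uo s (h : R0 < s) := (bo s h).1.
  have uR w (h : 0 < w < theta0) := (bR w h).1.
  have reg := weighted_regular eps delta M R0_gt0 theta0_gt0 C1u uo uR.
  have hE := iint_energy_weighted_le R0_gt0 theta0_gt0 eps01 delta01 M0 C1u uo uR hX.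
  have hJ := weighted_moment_le R0_gt0 theta0_gt0 M0 C1u uo uR (mq eps)
    (fun x _ => q0 eps x) (hb _ _ _ _ eps01 reg hE).
  apply: (@le_trans _ _ ((M `^ p * b)%:E `^ p^-1)%E).
    apply: gt0_ler_poweR => //; rewrite ?invr_ge0 ?ltW// in_itv/= ?leey ?andbT//.
    by rewrite lee_fin mulr_ge0// powR_ge0.
  rewrite poweR_EFin lee_fin powRM ?powR_ge0// -powRrM divff ?gt_eqF// (powRr1 (ltW M0)).
  by rewrite (mulrC M) ler_pM2r// lerDl.
have [Ny|] := eqVneq N +oo%E; first by rewrite Ny gt0_muley ?leey ?lte_fin.
case: N N0 key => [n|//|//]; rewrite lee_fin => n0 key _.
apply/lee_addgt0Pr => e e0; rewrite -EFinM -EFinD.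
(* This [M] is positive even for n = 0, and the constant times [M] is exactly the constant times n,
   plus e. *)
apply: le_trans (key (n + e / (b `^ p^-1 + 1)) _ _) _.
- by rewrite ltr_wpDl// divr_gt0.
- by rewrite lee_fin lerDl divr_ge0// ltW.
- by rewrite lee_fin mulrDr [X in _ + X]mulrC divfK ?gt_eqF.
Qed.

Theorem lemma2p10 (K : realType) (R0 theta0 : K)
    (R0_gt0 : 0 < R0) (theta0_gt0 : 0 < theta0) :
  (forall p : K, 4 <= p ->
     exists2 C : K, 0 < C &
       forall (eps delta : K) (u v P : K * K -> K),
         0 < eps <= 1 -> 0 <= delta <= 1 ->
         C1_on (Omega R0 theta0) u -> C1_on (Omega R0 theta0) v ->
         boundary_conditions R0 theta0 eps u v P ->
         divergence_free R0 theta0 eps u v ->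
         (iint R0 theta0
            (fun x => `|u x| `^ p * r_eps eps R0 x.2 `^ (delta * p / 2)
                      * r_eps eps R0 x.2 `^ 2^-1)%R `^ p^-1
          <= C%:E * normX R0 theta0 eps delta u)%E)
  /\
  (forall p : K, 2 <= p < 4 ->
     exists2 C : K, 0 < C &
       forall (eps delta : K) (u v P : K * K -> K),
         0 < eps <= 1 -> 0 <= delta <= 1 ->
         C1_on (Omega R0 theta0) u -> C1_on (Omega R0 theta0) v ->
         boundary_conditions R0 theta0 eps u v P ->
         divergence_free R0 theta0 eps u v ->
         (iint R0 theta0
            (fun x => `|u x| `^ p * r_eps eps R0 x.2 `^ (delta * p / 2))%R `^ p^-1
          <= C%:E * normX R0 theta0 eps delta u)%E).
Proof.
have mr eps : measurable_fun
    (Omega R0 theta0 : set (measurableTypeR K * measurableTypeR K))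
    (fun x => r_eps eps R0 x.2 `^ 2^-1).
  by apply: (measurableT_comp (measurable_powR 2^-1)); exact: measurable_r.
have E0 : 0 <= 2 + R0^-1 by rewrite addr_ge0// invr_ge0 ltW.
split => p hp.
  have p0 : 0 < p by apply: lt_le_trans hp.
  have [C C0 hC] := weighted_Lp_le_normX R0_gt0 theta0_gt0 p0 mr
    (fun eps x => powR_ge0 _ _) (bounded_moment_powR_sqrt theta0 R0_gt0 E0 hp).
  exists C => // eps delta u v P eps01 delta01 C1u _ bc _.
  exact: (hC eps delta u v P).
have p0 : 0 < p by case/andP: hp => + _; apply: lt_le_trans.
have m1 (eps : K) : measurable_fun
    (Omega R0 theta0 : set (measurableTypeR K * measurableTypeR K))
    (fun _ => 1 : K) by exact: measurable_cst.
have [C C0 hC] := weighted_Lp_le_normX R0_gt0 theta0_gt0 p0 m1 (fun _ _ => ler01)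
  (bounded_moment_powR theta0 R0_gt0 E0 hp).
exists C => // eps delta u v P eps01 delta01 C1u _ bc _.
by have := hC eps delta u v P eps01 delta01 C1u bc; under eq_iint do rewrite mulr1.
Qed.
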